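(* Let $(\{f_i\}_{i\in I},\mathbb{T})$ be a general IFS with uniform contraction constant $c\in(0,1)$ on a complete metric space $(X,\rho)$, and for each $i\in I$ let $z_i\in X$ be the unique fixed point of $f_i$. Suppose that there exists $x\in X$ such that $$\sum_{n\in\mathbb{N}}\Big\{\max_{i\in I_n}\rho(x,z_i)\Big\}\cdot c^n<\infty .$$ Put $b_x(l):=\sum_{k\ge l}\{\max_{i\in I_k}\rho(x,z_i)\}\cdot c^k$ for $l\in\mathbb{N}$. Then the family $\{\pi(\mathbb{T}_\omega)\}_{\omega\in\mathbb{T}^{[1,*]}}$ of limit sets has the following properties: (i) for each $\omega\in\mathbb{T}^{[1,*]}$ and each $n\in\mathbb{N}$, $$\bigcup_{\omega'\in\mathbb{T}_\omega^{[1,n]}}f_{\omega'}\big(\pi(\mathbb{T}_{\omega\omega'})\big)=\pi(\mathbb{T}_\omega);$$ (ii) for each $A\in\mathcal{K}(X)$ there exists $D'(A)>0$ such that for each $\omega\in\mathbb{T}^{[1,*]}$, $$\rho_H(A,\pi(\mathbb{T}_\omega))\le D'(A)\cdot\max\left\{1,\;c^{-(|\omega|+1)}\,b_x(|\omega|+1)\right\}.$$ In addition, the family of non-empty compact subsets of $X$ indexed by $\mathbb{T}^{[1,*]}$ with properties (i) and (ii) is unique: if $\{K_\omega\}_{\omega\in\mathbb{T}^{[1,*]}}\subset\mathcal{K}(X)$ satisfies (i) and (ii) with $K_\omega$ in place of $\pi(\mathbb{T}_\omega)$ for every $\omega \in \mathbb{T}^{[1,*]}$, then $K_\omega=\pi(\mathbb{T}_\omega)$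 for every $\omega\in\mathbb{T}^{[1,*]}$. Moreover, for each $A\in\mathcal{K}(X)$ there exists $D(A)>0$ such that for each $\omega\in\mathbb{T}^{[1,*]}$ and $n\in\mathbb{N}$, $$\rho_H\Big(\bigcup_{\omega'\in\mathbb{T}_\omega^{[1,n]}}f_{\omega'}(A),\ \pi(\mathbb{T}_\omega)\Big)\le D(A)\cdot c^{-(|\omega|+1)}\cdot\max\{c^{\,n+|\omega|+1},\ b_x(n+|\omega|+1)\}.$$
   Context: $\mathbb{N}$ is the set of positive integers. Words. $I$ is a countable set (alphabet) with the discrete topology, and $I^{\mathbb{N}}$ carries the product topology. $\phi$ denotes the empty word, with length $|\phi|=0$; a word $\omega\in I^n$ has length $|\omega|=n$. $\omega\omega'$ denotes concatenation. For $\omega=\omega_1\omega_2\cdots\in I^{\mathbb{N}}$, $\omega_{[m,n]}:=\omega_m\cdots\omega_n$ and $\omega_{(m,\infty)}:=\omega_{m+1}\omega_{m+2}\cdots$. Trees. A tree with $I$ is a non-empty closed subset $\mathbb{T}\subset I^{\mathbb{N}}$ such that $S(\mathbb{T},\phi):=\{\omega_1 : \omega\in\mathbb{T}\}$ is finite and, for each $n\in\mathbb{N}$ and $\omega\in\mathbb{T}$, the set $S(\mathbb{T},\omega_{[1,n]}):=\{\tau_{n+1} : \tau\in\mathbb{T},\ \tau_{[1,n]}=\omega_{[1,n]}\}$ is finite. Put $\mathbb{T}^{[1,n]}:=\{\omega_{[1,n]} : \omega\in\mathbb{T}\}$, $\mathbb{T}^{[1,*]}:=\{\phi\}\cup\bigcup_{n\in\mathbb{N}}\mathbb{T}^{[1,n]}$,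 $I_1:=S(\mathbb{T},\phi)$ and $I_n:=\bigcup_{\tau\in\mathbb{T}^{[1,n-1]}}S(\mathbb{T},\tau)$ for $n\ge2$; each $I_n$ is a finite set. For $\omega\in\mathbb{T}^{[1,*]}$ the sub-tree is $\mathbb{T}_\omega:=\{\tau_{(|\omega|,\infty)} : \tau\in\mathbb{T},\ \tau_{[1,|\omega|]}=\omega\}$ (with $\mathbb{T}_\phi=\mathbb{T}$), which is again a tree with $I$; put $\mathbb{T}_\omega^{[1,n]}:=\{\tau_{[1,n]}:\tau\in\mathbb{T}_\omega\}$. General IFS. A general IFS on a complete metric space $(X,\rho)$ with uniform contraction constant $c\in(0,1)$ is a pair $(\{f_i\}_{i\in I},\mathbb{T})$ where $\mathbb{T}$ is a tree with $I$ and $f_i\colon X\to X$ satisfy $\rho(f_i(x),f_i(y))\le c\,\rho(x,y)$ for all $i\in I$, $x,y\in X$. For a word $\omega=\omega_1\cdots\omega_n$, $f_\omega:=f_{\omega_1}\circ\cdots\circ f_{\omega_n}$, and $f_\phi:=\mathrm{id}_X$. Projection map. Under the summability assumption of the claim, for each $\omega\in\mathbb{T}$ there is a unique sequence $\{x_m\}_{m\in\mathbb{N}}$ in $X$ such that $f_{\omega_m}(x_{m+1})=x_m$ for all $m\in\mathbb{N}$ and such that there is $C>0$ with $\rho(y,x_m)\le C\,c^{-m}\sum_{k\ge m}c^k\rho(y,z_{\omega_k})$ for all $y\in X$, $m\in\mathbb{N}$. The projection map $\pi\colon\mathbb{T}\to X$ is $\pi(\omega):=x_1$. The general IFS $(\{f_i\}_{i\in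 I},\mathbb{T}_\omega)$ satisfies the same summability assumption for each $\omega\in\mathbb{T}^{[1,*]}$, and its projection map $\mathbb{T}_\omega\to X$ (defined in the same way) is also denoted by $\pi$. The limit set of $(\{f_i\}_{i\in I},\mathbb{T}_\omega)$ is $\pi(\mathbb{T}_\omega)$, which is a non-empty compact subset of $X$. $\mathcal{K}(X)$ is the set of non-empty compact subsets of $X$, and $\rho_H$ is the Hausdorff distance on $\mathcal{K}(X)$. *)

(* Defs.v *)
From HB Require Import structures.
From mathcomp Require Import all_boot all_order all_algebra.
From mathcomp Require Import all_classical all_reals all_analysis.

Set Implicit Arguments.
Unset Strict Implicit.
Unset Printing Implicit Defensive.
Import Order.TTheory GRing.Theory Num.Theory.
Import numFieldNormedType.Exports.

Local Open Scope classical_set_scope.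
Local Open Scope ring_scope.

(* The library's Complete extends pointed uniform spaces, hence X comes with a
   distinguished point: this only says that X is non-empty. *)
#[short(type="completeMetricType")]
HB.structure Definition CompleteMetric (R : numDomainType) :=
  {T of Metric R T & Complete T}.

(* Letters are indexed from 0: the sequence omega_1 omega_2 ... is the function
   w with w k = omega_(k+1), so the word omega_[1,n] is [w 0; ...; w (n-1)]
   and omega_(n,oo) is k |-> w (n + k). *)
Section Trees.
Variable I : countType.
Implicit Types (T : set (nat -> I)) (w : nat -> I) (s : seq I).

Definition prefix_of w (n : nat) : seq I := mkseq w n.

Definition shift_by (n : nat) w : nat -> I := fun k => w (n + k)%N.

Definition through T s : set (nat -> I) :=
  [set w | T w /\ prefix_of w (size s) = s].

(* S(T, s) *)
Definition successors T s : set I := [set w (size s) | w in through T s].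

Definition is_tree T : Prop :=
  [/\ T !=set0,
      closed (T : set {ptws nat -> discrete_topology I}),
      finite_set (successors T [::])
    & forall n w, (0 < n)%N -> T w -> finite_set (successors T (prefix_of w n))].

(* T^[1,n] *)
Definition words_of_length T (n : nat) : set (seq I) :=
  [set prefix_of w n | w in T].

(* T^[1,*] *)
Definition words T : set (seq I) :=
  [set [::]] `|` \bigcup_(n in [set n | (0 < n)%N]) words_of_length T n.

(* I_n, meant for n >= 1 *)
Definition letters T (n : nat) : set I :=
  if n == 1%N then successors T [::]
  else \bigcup_(s in words_of_length T n.-1) successors T s.

(* T_s *)
Definition subtree T s : set (nat -> I) := shift_by (size s) @` through T s.

End Trees.

(* The distances below take values in \bar R, so that no convention is needed
   for suprema and infima of sets that are empty or unbounded; on non-empty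
   compact sets, hausdorff_dist is the usual, finite, Hausdorff distance. *)
Section Hausdorff.
Context {R : realType} {X : metricType R}.
Implicit Types A B : set X.
Local Open Scope ereal_scope.

Definition dist_to (a : X) B : \bar R := ereal_inf [set (mdist a b)%:E | b in B].

Definition hausdorff_dist A B : \bar R :=
  maxe (ereal_sup [set dist_to a B | a in A])
       (ereal_sup [set dist_to b A | b in B]).

(* K(X) *)
Definition nonempty_compact A : Prop := A !=set0 /\ compact A.

End Hausdorff.

Section GeneralIFS.
Context {R : realType} {X : completeMetricType R} {I : countType}.
Variables (c : R) (f : I -> X -> X) (z : I -> X).
Implicit Types (T : set (nat -> I)) (w : nat -> I) (s : seq I).
Implicit Types (xs : nat -> X) (K : seq I -> set X) (x : X).

Definition general_ifs T : Prop :=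
  [/\ is_tree T, 0 < c < 1
    & forall i x y, mdist (f i x) (f i y) <= c * mdist x y].

(* f_s, with f_[::] the identity *)
Definition word_map s : X -> X := foldr (fun i g => f i \o g) id s.

(* max_(i in I_n) rho(x, z_i); for a tree, I_n is finite and non-empty when
   n >= 1, and the supremum is a maximum. *)
Definition max_dist T x (n : nat) : \bar R :=
  ereal_sup [set (mdist x (z i))%:E | i in letters T n].

(* b_x(l), for l >= 1; the summability assumption is b_x(1) < +oo *)
Definition tail_sum T x (l : nat) : \bar R :=
  (\sum_(l <= k <oo) max_dist T x k * (c ^+ k)%:E)%E.

(* The conditions that determine (x_m)_(m >= 1), with xs m = x_(m+1) *)
Definition projection_seq w xs : Prop :=
  (forall m, f (w m) (xs m.+1) = xs m) /\
  exists2 C : R, 0 < C & forall y m,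
    ((mdist y (xs m))%:E <= (C * c ^- m.+1)%:E *
       \sum_(m <= k <oo) (c ^+ k.+1 * mdist y (z (w k)))%:E)%E.

(* pi(w) = x_1; under the summability assumption such a sequence exists and is
   unique for every w in T_s, so that the default value of get is not used. *)
Definition projection w : X :=
  get [set x | exists2 xs, projection_seq w xs & xs 0%N = x].

Definition limit_set T : set X := projection @` T.

(* Properties (i) and (ii) of a family K indexed by T^[1,*]; the values of K
   outside T^[1,*] play no role. *)
Definition self_similar T K : Prop :=
  forall s n, words T s -> (0 < n)%N ->
    \bigcup_(s' in words_of_length (subtree T s) n)
      (word_map s' @` K (s ++ s')) = K s.

Definition controlled_growth T x K : Prop :=
  forall A : set X, nonempty_compact A ->
    exists2 D : R, 0 < D & forall s, words T s ->
      (hausdorff_dist A (K s) <=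
         D%:E * maxe 1 ((c ^- (size s).+1)%:E * tail_sum T x (size s).+1))%E.

End GeneralIFS.

(* Main.v *)
Require Import Defs.
From HB Require Import structures.
From mathcomp Require Import all_boot all_order all_algebra.
From mathcomp Require Import all_classical all_reals all_analysis.
From mathcomp Require Import ring lra.

Set Implicit Arguments.
Unset Strict Implicit.
Unset Printing Implicit Defensive.
Import Order.TTheory GRing.Theory Num.Theory.
Import numFieldNormedType.Exports.

Local Open Scope classical_set_scope.
Local Open Scope ring_scope.

(** Why the theorem is true.  Fix an infinite word [w] and a base point [y].  The
    points [f_{w_1} ... f_{w_n}(y)] form a sequence whose [n]-th step is at most
    [(1 + c) c^n rho(y, z_{w_{n+1}})], because [y] moves by at most
    [(1 + c) rho(y, z_i)] under [f_i].  Whenever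
    [sum_k c^k rho(y, z_{w_k})] is finite the sequence therefore converges, at a
    distance from [y] which that sum controls.  Its limit does not depend on [y],
    since the compositions contract; applying this to all shifts of [w] gives the
    sequence that defines the projection, with the constant [C = 1 + c].

    For [w] in the subtree at [s] the letter [w_k] belongs to level [|s| + k], so
    the sum at [x] is at most [c^{-|s|} b_x(|s| + 1)].  Thus the limit set at [s]
    lies within [(1 + c) c^{-(|s|+1)} b_x(|s| + 1)] of [x] ([mdist_limit_set]),
    which is property (ii).  Property (i) says that the projection intertwines
    the shift with the maps [f_i] ([projection_prefix]).

    All the rest is one rescaling ([mdist_word_map_growth]).  Applying the maps
    of a word of length [n] multiplies distances by at most [c^n], and [c^n]
    times the growth bound at level [|s| + n] is
    [c^{-(|s|+1)} max(c^{n+|s|+1}, b_x(n+|s|+1))], which vanishes as [n] grows.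
    This gives the last estimate directly.  It makes the projection continuous
    on the tree, which is compact by Tychonoff's theorem, so limit sets are
    compact.  Finally, if two families satisfy (i) and (ii), every point of one
    is [f_{s'}(b')] with [b'] in its member at [s s'], and [f_{s'}(a')], for any
    [a'] in the other family's member at [s s'], is arbitrarily close to it: each
    member is contained in the closure of the other ([controlled_family_sub]). *)

(** * Words, subtrees and compactness of trees *)

Section Words.
Variable I : countType.
Implicit Types (T : set (nat -> I)) (w v : nat -> I) (s : seq I).

Lemma size_prefix_of w n : size (prefix_of w n) = n.
Proof. exact: size_mkseq. Qed.

Lemma prefix_of_cat w m n :
  prefix_of w (m + n) = prefix_of w m ++ prefix_of (shift_by m w) n.
Proof.
rewrite /prefix_of /mkseq iotaD map_cat add0n; congr (_ ++ _).
by rewrite -{1}[m]addn0 iotaDl -map_comp.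
Qed.

Lemma shift_by_add w m n : shift_by (m + n) w = shift_by n (shift_by m w).
Proof. by apply/funext => k; rewrite /shift_by addnA. Qed.

Lemma subtree_nil T : subtree T [::] = T.
Proof.
apply/seteqP; split => w; last by move=> Tw; exists w.
by case=> v [Tv _] <-.
Qed.

(** Descending along [s] and then along [s'] is descending along [s ++ s']; this
    is what lets every estimate for [subtree T s] be reused deeper in the tree. *)
Lemma subtree_cat T s s' : subtree T (s ++ s') = subtree (subtree T s) s'.
Proof.
apply/seteqP; split => w.
  case=> v [Tv]; rewrite size_cat prefix_of_cat => /eqP.
  rewrite eqseq_cat ?size_prefix_of// => /andP[/eqP vs /eqP vs'] <-.
  exists (shift_by (size s) v); last by rewrite shift_by_add.
  by split => //; exists v.
case=> _ [[v [Tv vs] <-] vs'] <-; exists v.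
  by split; rewrite // size_cat prefix_of_cat vs vs'.
by rewrite size_cat shift_by_add.
Qed.

Lemma shift_subtree T w n : T w -> subtree T (prefix_of w n) (shift_by n w).
Proof.
by move=> Tw; exists w; [split=> //|]; rewrite size_prefix_of.
Qed.

Lemma subtree_nonempty T s : T !=set0 -> words T s -> subtree T s !=set0.
Proof.
move=> T0 [->|[n _ [w Tw <-]]]; first by rewrite subtree_nil.
by exists (shift_by n w); exact: shift_subtree.
Qed.

Lemma words_cat T s n s' :
  words_of_length (subtree T s) n s' -> words T (s ++ s').
Proof.
case=> _ [v [Tv vs] <-] <-; rewrite -{1}vs -prefix_of_cat.
case: (size s + n)%N => [|k]; first by left.
by right; exists k.+1 => //; exists v.
Qed.

Lemma size_words_of_length T n s : words_of_length T n s -> size s = n.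
Proof. by case=> w _ <-; exact: size_prefix_of. Qed.

Lemma letters_nth T w k : T w -> letters T k.+1 (w k).
Proof.
move=> Tw; rewrite /letters; case: k => [|k] /=; first by exists w.
exists (prefix_of w k.+1); first by exists w.
by exists w; [split=> //|]; rewrite size_prefix_of.
Qed.

(** The bookkeeping that turns sums along a word of a subtree into tails of the
    series of the tree: below [s], letters sit [size s] levels deeper. *)
Lemma letters_subtree T s w k :
  subtree T s w -> letters T (size s + k).+1 (w k).
Proof. by case=> v [Tv _] <-; exact: letters_nth. Qed.

(** Reindexing a series requires its terms to be nonnegative at every index, also
    at 0, where no level of the tree lives; there nonnegativity comes from level 1. *)
Lemma letters0 T : T !=set0 -> letters T 0 = letters T 1.
Proof.
move=> [w Tw]; rewrite /letters/=; apply/seteqP; split => i.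
  by case=> s [v _ <-].
by move=> ?; exists [::] => //; exists w.
Qed.

Lemma finite_words_of_length T n : is_tree T -> finite_set (words_of_length T n).
Proof.
case=> _ _ fin0 finS; elim: n => [|n IHn].
  apply: (@sub_finite_set _ _ [set [::]]); last exact: finite_set1.
  by move=> s [w _ <-].
apply: (@sub_finite_set _ _
   (\bigcup_(s in words_of_length T n) (rcons s @` successors T s))).
  move=> _ [w Tw <-]; exists (prefix_of w n); first by exists w.
  exists (w n); last by rewrite /prefix_of mkseqS.
  by exists w; [split=> //|]; rewrite size_prefix_of.
apply: bigcup_finite => // s [w Tw <-]; apply: finite_image.
by case: n {IHn} => [|n]; [exact: fin0|exact: finS].
Qed.

Lemma finite_letters T n : is_tree T -> finite_set (letters T n).
Proof.
move=> treeT; have [_ _ fin0 finS] := treeT; rewrite /letters.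
case: eqP => _; first exact: fin0.
apply: bigcup_finite; first exact: finite_words_of_length.
by move=> s [w Tw <-]; case: n.-1 => [|k]; [exact: fin0|exact: finS].
Qed.

Let code := {ptws nat -> discrete_topology I}.

Lemma nbhs_coordinate (w : code) k :
  nbhs w ([set v | v k = w k] : set code).
Proof.
have := @proj_continuous nat (fun=> discrete_topology I) k w.
move=> /(_ [set w k]); apply.
apply: open_nbhs_nbhs; split => //; exact: discrete_open.
Qed.

Lemma nbhs_cylinder (w : code) n :
  nbhs w ([set v | prefix_of v n = prefix_of w n] : set code).
Proof.
have nbhsF : Filter (nbhs w) by exact: nbhs_filter.
elim: n => [|n IHn]; first exact: filterE.
apply: filterS (filterI IHn (nbhs_coordinate w n)) => v [] /=.
by rewrite /prefix_of !mkseqS => -> ->.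
Qed.

Lemma closed_cylinder n s : closed ([set w | prefix_of w n = s] : set code).
Proof.
move=> w clw; have [v [/= vs vw]] := clw _ (nbhs_cylinder w n).
by rewrite /= -vw.
Qed.

(** A tree is a closed part of the product of its finite letter sets. *)
Lemma compact_through T s : is_tree T -> compact (through T s : set code).
Proof.
move=> treeT; have [_ clT _ _] := treeT.
have letters_compact k :
    compact (letters T k.+1 : set (discrete_topology I)).
  exact/finite_compact/finite_letters.
have := @tychonoff nat (fun=> discrete_topology I) _ letters_compact.
move=> /subclosed_compact; apply; last by move=> w [Tw _] k; exact: letters_nth.
by apply: closedI => //; exact: closed_cylinder.
Qed.

End Words.

(** * Metric preliminaries *)

Lemma compact_mdist_bounded (R : realType) (X : metricType R) (A : set X)
    (x : X) :
  compact A -> exists2 M : R, 0 < M & forall a, A a -> mdist a x <= M.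
Proof.
move=> cA.
have mdist_cont : continuous (fun a : X => mdist a x : R).
  move=> a; apply/cvgrPdist_lt => eps eps0; near=> b.
  have ab : mdist a b < eps.
    by near: b; exact: (metricType_numDomainType.cvgr_dist_lt _ eps0).
  rewrite ltr_norml; apply/andP.
  have := metric_triangle a b x; have := metric_triangle b a x.
  by rewrite (metric_sym b a); split; lra.
have /compact_bounded[M [_ /(_ (`|M| + 1))]] :
    compact ((fun a : X => mdist a x : R) @` A).
  by apply: continuous_compact => //; exact: continuous_subspaceT.
rewrite (le_lt_trans (ler_norm M)) ?ltrDl// => /(_ isT) bound.
exists (`|M| + 1); first by rewrite ltr_wpDl.
move=> a Aa; apply: le_trans (ler_norm _) _.
by apply: bound; exists a.
Unshelve. all: by end_near. Qed.

Section MetricLemmas.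
Context {R : realType}.

Lemma nneseries_tail_lt (e : nat -> \bar R) (eps : R) :
  (forall k, (0 <= e k)%E) -> (\sum_(0 <= k <oo) e k < +oo)%E -> 0 < eps ->
  exists N, forall n, (N <= n)%N -> (\sum_(n <= k <oo) e k < eps%:E)%E.
Proof.
move=> e0 efin eps0.
have := nneseries_tail_cvg efin (fun k _ => e0 k).
move=> /fine_cvgP[/= finN /cvgrPdist_lt /(_ _ eps0) ltN].
have [N _ NP] := filterI finN ltN; exists N => n Nn.
have [/= fn] := NP n Nn; rewrite sub0r normrN => /ltr_normlW lt_n.
by rewrite -(fineK fn) lte_fin.
Qed.

(** A matching of each set into the other, even one that is far from optimal,
    bounds the Hausdorff distance. *)
Lemma hausdorff_dist_le {X : metricType R} (A B : set X) (r : \bar R) :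
  (forall a, A a -> exists2 b, B b & ((mdist a b)%:E <= r)%E) ->
  (forall b, B b -> exists2 a, A a & ((mdist b a)%:E <= r)%E) ->
  (hausdorff_dist A B <= r)%E.
Proof.
move=> AB BA; rewrite /hausdorff_dist ge_max; apply/andP; split.
  apply/ereal_supP => _ [a /AB[b Bb abr] <-].
  by apply: le_trans abr; apply: ereal_inf_lbound; exists b.
apply/ereal_supP => _ [b /BA[a Aa bar] <-].
by apply: le_trans bar; apply: ereal_inf_lbound; exists a.
Qed.

(** The Hausdorff distance to a singleton is the greatest distance to its point:
    property (ii) for a singleton confines a member of a family to a ball. *)
Lemma mdist_le_hausdorff_set1 {X : metricType R} (x b : X) (B : set X) :
  B b -> ((mdist x b)%:E <= hausdorff_dist [set x] B)%E.
Proof.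
move=> Bb; rewrite /hausdorff_dist le_max; apply/orP; right.
apply: le_trans (ereal_sup_ubound _); last by exists b.
by apply/ereal_infP => _ [_ -> <-]; rewrite metric_sym.
Qed.

Lemma cvg_of_summable_steps {X : completeMetricType R} (p : nat -> X)
    (e : nat -> R) :
  (forall n, mdist (p n) (p n.+1) <= e n) ->
  (\sum_(0 <= k <oo) (e k)%:E < +oo)%E ->
  exists2 l, p @ \oo --> l &
    ((mdist (p 0%N) l)%:E <= \sum_(0 <= k <oo) (e k)%:E)%E.
Proof.
move=> pe efin.
have e0 k : (0 <= (e k)%:E)%E.
  by rewrite lee_fin (le_trans _ (pe k))// mdist_ge0.
have step n m : ((mdist (p n) (p (n + m)%N))%:E <=
    \sum_(n <= k <oo) (e k)%:E)%E.
  apply: (@le_trans _ _ (\sum_(n <= k < n + m) (e k)%:E)%E); last first.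
    by apply: nneseries_lim_ge => ? _ _; exact: e0.
  elim: m => [|m IHm]; first by rewrite addn0 mdistxx big_geq.
  rewrite addnS big_nat_recr ?leq_addr//=.
  have pem : ((mdist (p (n + m)%N) (p (n + m).+1))%:E <= (e (n + m)%N)%:E)%E.
    by rewrite lee_fin.
  by apply: le_trans (leeD IHm pem); rewrite -EFinD lee_fin metric_triangle.
have : cauchy (p @ \oo).
  apply: (@cauchy_exP R X) => eps eps0.
  have [N NP] := nneseries_tail_lt e0 efin eps0.
  exists (p N); rewrite ballEmdist; exists N => //= n /= Nn.
  rewrite -lte_fin -(subnKC Nn); apply: le_lt_trans (step _ _) _.
  exact: NP.
move=> /(@cauchy_cvgP X) cvp.
have {cvp} [l pl] : exists l : X, p @ \oo --> l by exists (lim (p @ \oo) : X).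
exists l => //; apply/lee_addgt0Pr => eps eps0.
have /= := metricType_numDomainType.cvgr_dist_lt pl eps0.
move=> -[N _ /(_ N (leqnn N))] /= lN.
have {}lN : ((mdist l (p N))%:E <= eps%:E)%E by rewrite lee_fin ltW.
apply: le_trans (leeD (step 0%N N) lN).
by rewrite -EFinD lee_fin add0n [mdist l _]metric_sym metric_triangle.
Qed.

End MetricLemmas.

(** * The projection map along one infinite word *)

Section ProjectionMap.
Context {R : realType} {X : completeMetricType R} {I : countType}.
Variables (c : R) (f : I -> X -> X) (z : I -> X).
Hypothesis c01 : 0 < c < 1.
Hypothesis f_contracts : forall i x y, mdist (f i x) (f i y) <= c * mdist x y.
Hypothesis z_fixed : forall i, f i (z i) = z i.
Implicit Types (w : nat -> I) (x y : X) (s : seq I) (xs : nat -> X).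

Let c_gt0 : 0 < c. Proof. by case/andP: c01. Qed.
Let c_ge0 : 0 <= c. Proof. exact: ltW. Qed.
Let c_neq0 : c != 0. Proof. exact: lt0r_neq0. Qed.

(** With one-based indices, [spread y w k] is [c^m rho(y, z_{w_m})] for
    [m = k + 1], and [spread_sum y w m] is the series that bounds the distance from
    [y] to the [m]-th point (from 0) of a projection sequence. *)
Definition spread y w (k : nat) : R := c ^+ k.+1 * mdist y (z (w k)).

Definition spread_sum y w (m : nat) : \bar R :=
  (\sum_(m <= k <oo) (spread y w k)%:E)%E.

Lemma spread_ge0 y w k : (0 <= (spread y w k)%:E)%E.
Proof. by rewrite lee_fin mulr_ge0 ?exprn_ge0 ?mdist_ge0. Qed.

Lemma spread_sum_ge0 y w m : (0 <= spread_sum y w m)%E.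
Proof. by apply: nneseries_ge0 => k _ _; exact: spread_ge0. Qed.

Lemma spread_sum_shift y w m n :
  spread_sum y (shift_by n w) m = ((c ^- n)%:E * spread_sum y w (n + m))%E.
Proof.
rewrite /spread_sum -(nneseries_addn (n + m)); last exact: spread_ge0.
rewrite -(nneseries_addn m); last exact: spread_ge0.
rewrite -nneseriesZl; last by move=> k _; exact: spread_ge0.
apply: eq_eseriesr => k _; rewrite -EFinM; congr EFin.
rewrite /spread /shift_by (addnCA k n m) -[(n + _).+1]addnS (exprD c n) !mulrA.
by rewrite mulVf ?mul1r// expf_neq0.
Qed.

Lemma spread_sum_shift_lty y w n :
  (spread_sum y w 0 < +oo)%E -> (spread_sum y (shift_by n w) 0 < +oo)%E.
Proof.
rewrite spread_sum_shift addn0 {1}/spread_sum (nneseries_split 0 n); last first.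
  by move=> k _; exact: spread_ge0.
move=> fin_sum; apply: lte_mul_pinfty => //.
- by rewrite lee_fin invr_ge0 exprn_ge0.
- apply: le_lt_trans fin_sum; apply: leeDr.
  by apply: sume_ge0 => k _; exact: spread_ge0.
Qed.

Lemma word_map_cat s t y :
  word_map f (s ++ t) y = word_map f s (word_map f t y).
Proof. by elim: s => //= i s ->. Qed.

Lemma word_map_contracts s x y :
  mdist (word_map f s x) (word_map f s y) <= c ^+ size s * mdist x y.
Proof.
elim: s => [|i s IHs] /=; first by rewrite mul1r.
by rewrite exprS -mulrA (le_trans (f_contracts _ _ _))// ler_wpM2l.
Qed.

(** The [f_i]-displacement of [y] is at most [(1 + c) rho(y, z_i)], by going
    through the fixed point [z_i]; the earlier maps contract it by [c^n]. *)
Lemma word_map_prefix_step y w n :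
  mdist (word_map f (prefix_of w n) y) (word_map f (prefix_of w n.+1) y) <=
  (1 + c) / c * spread y w n.
Proof.
rewrite -addn1 prefix_of_cat word_map_cat /= /shift_by addn0.
apply: le_trans (word_map_contracts _ _ _) _.
have -> : (1 + c) / c * spread y w n =
    c ^+ n * (mdist y (z (w n)) + c * mdist y (z (w n))).
  by rewrite /spread exprS; field.
rewrite size_prefix_of ler_wpM2l ?exprn_ge0//.
apply: le_trans (metric_triangle _ (z (w n)) _) _.
rewrite lerD2l -{1}(z_fixed (w n)) metric_sym.
exact: f_contracts.
Qed.

Lemma cvg_word_map y w : (spread_sum y w 0 < +oo)%E ->
  exists2 l, word_map f (prefix_of w n) y @[n --> \oo] --> l &
    ((mdist y l)%:E <= ((1 + c) / c)%:E * spread_sum y w 0)%E.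
Proof.
move=> fin_sum.
have sumE : (\sum_(0 <= k <oo) ((1 + c) / c * spread y w k)%:E =
    ((1 + c) / c)%:E * spread_sum y w 0)%E.
  rewrite -nneseriesZl; last by move=> k _; exact: spread_ge0.
  by apply: eq_eseriesr => k _; rewrite EFinM.
have [|l cvl yl] := cvg_of_summable_steps (word_map_prefix_step y w).
  rewrite sumE; apply: lte_mul_pinfty => //.
  by rewrite lee_fin divr_ge0// addr_ge0.
by exists l => //; rewrite -sumE.
Qed.

Lemma cvg_word_map_base x y w (l : X) :
  word_map f (prefix_of w n) x @[n --> \oo] --> l ->
  word_map f (prefix_of w n) y @[n --> \oo] --> l.
Proof.
move=> xl; apply/metricType_numDomainType.cvgrPdist_lt => eps eps0.
have e20 : 0 < eps / 2 by rewrite divr_gt0.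
have cvc : c ^+ n * mdist x y @[n --> \oo] --> (0 : R).
  rewrite -(mul0r (mdist x y)); apply: cvgM; last exact: cvg_cst.
  by apply: cvg_expr; rewrite ger0_norm//; case/andP: c01.
near=> n; rewrite (splitr eps).
apply: le_lt_trans (metric_triangle _ (word_map f (prefix_of w n) x) _) _.
apply: ltrD.
  by near: n; exact: metricType_numDomainType.cvgr_dist_lt.
apply: le_lt_trans (word_map_contracts _ _ _) _; rewrite size_prefix_of.
rewrite -[ltLHS]ger0_norm ?mulr_ge0 ?exprn_ge0 ?mdist_ge0//.
rewrite -normrN -sub0r.
by near: n; move/cvgrPdist_lt: cvc; apply.
Unshelve. all: by end_near. Qed.

Lemma f_continuous i : continuous (f i).
Proof.
move=> a; apply/metricType_numDomainType.cvgrPdist_lt => eps eps0.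
near=> b; apply: le_lt_trans (f_contracts _ _ _) _.
rewrite mulrC -ltr_pdivlMr//; near: b.
have e20 : 0 < eps / c by rewrite divr_gt0.
exact: (metricType_numDomainType.cvgr_dist_lt _ e20).
Unshelve. all: by end_near. Qed.

(** The [m]-th point is the limit of the compositions along [w] shifted by [m].
    Finiteness of the series at the single point [x] suffices: where the series
    at [y] diverges the bound is vacuous, and elsewhere the limit computed from
    [y] is the one computed from [x]. *)
Lemma exists_projection_seq x w : (spread_sum x w 0 < +oo)%E ->
  exists2 xs, projection_seq c f z w xs &
    forall y, ((mdist y (xs 0%N))%:E <= ((1 + c) / c)%:E * spread_sum y w 0)%E.
Proof.
move=> fin_sum.
have /choice[xs xsP] m : exists l : X,
    word_map f (prefix_of (shift_by m w) n) x @[n --> \oo] --> l.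
  by have [l] := cvg_word_map (spread_sum_shift_lty m fin_sum); exists l.
have bound y m : ((mdist y (xs m))%:E <=
    ((1 + c) * c ^- m.+1)%:E * spread_sum y w m)%E.
  have fac0 : (0 < ((1 + c) * c ^- m.+1)%:E)%E.
    by rewrite lte_fin mulr_gt0 ?addr_gt0// invr_gt0 exprn_gt0.
  (* An infinite series at y makes the right-hand side infinite. *)
  have [ltoo|] := ltP (spread_sum y (shift_by m w) 0) +oo%E; last first.
    rewrite leye_eq spread_sum_shift addn0 => /eqP sum_oo.
    have -> : spread_sum y w m = +oo%E.
      case: (spread_sum y w m) sum_oo (spread_sum_ge0 y w m) => //.
    by rewrite gt0_muley// leey.
  have [l cvl yl] := cvg_word_map ltoo.
  have -> : xs m = l.
    apply: (cvg_unique (@metric_hausdorff _ X) _ cvl).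
    exact: cvg_word_map_base (xsP m).
  apply: le_trans yl _.
  by rewrite spread_sum_shift addn0 muleA -EFinM -mulrA -invfM -exprS.
exists xs.
  split; last by exists (1 + c); [exact: addr_gt0|exact: bound].
  move=> m; apply: (@cvg_unique _ (@metric_hausdorff _ X)
    ((fun n => word_map f (prefix_of (shift_by m w) n.+1) x) @ \oo)); last first.
    by have := xsP m; rewrite -(cvg_shiftS _ (nbhs _)).
  have -> : (fun n => word_map f (prefix_of (shift_by m w) n.+1) x) =
      f (w m) \o (fun n => word_map f (prefix_of (shift_by m.+1 w) n) x).
    apply/funext => n.
    rewrite -add1n prefix_of_cat word_map_cat /= {1}/shift_by addn0.
    by rewrite -shift_by_add addn1.
  exact: cvg_comp (xsP m.+1) (@f_continuous (w m) (xs m.+1)).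
by move=> y; have := bound y 0%N; rewrite expr1.
Qed.

Lemma projection_seq_word_map w xs n : projection_seq c f z w xs ->
  xs 0%N = word_map f (prefix_of w n) (xs n).
Proof.
move=> [xsE _]; elim: n => // n ->.
by rewrite -addn1 prefix_of_cat word_map_cat /= /shift_by addn0 addn1 xsE.
Qed.

Lemma projection_seq_shift w xs n : projection_seq c f z w xs ->
  projection_seq c f z (shift_by n w) (fun m => xs (n + m)%N).
Proof.
move=> [xsE [C C0 bound]]; split; first by move=> m; rewrite addnS xsE.
exists C => // y m; apply: le_trans (bound y (n + m)%N) _.
change ((C * c ^- (n + m).+1)%:E * spread_sum y w (n + m) <=
        (C * c ^- m.+1)%:E * spread_sum y (shift_by n w) m)%E.
by rewrite spread_sum_shift muleA -EFinM -mulrA -invfM -exprD addSn [(m + n)%N]addnC.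
Qed.

(** The first points are images under [m] contractions of the [m]-th ones, whose
    distance is [O(c^{-m})] times the [m]-th tail; the powers of [c] cancel. *)
Lemma projection_seq_unique x w xs ys : (spread_sum x w 0 < +oo)%E ->
  projection_seq c f z w xs -> projection_seq c f z w ys -> xs 0%N = ys 0%N.
Proof.
move=> fin_sum xsP ysP.
have [_ [C C0 xsC]] := xsP; have [_ [D D0 ysD]] := ysP.
apply: mdist_positivity; apply/eqP; rewrite eq_le mdist_ge0 andbT.
apply/ler_addgt0Pl => eps eps0; rewrite addr0.
have CD0 : 0 < (C + D) / c by rewrite divr_gt0// addr_gt0.
have [|m /(_ m (leqnn m)) tail_m] :=
  nneseries_tail_lt (spread_ge0 x w) fin_sum (eps := eps / ((C + D) / c)).
  by rewrite divr_gt0.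
rewrite (projection_seq_word_map m xsP) (projection_seq_word_map m ysP).
apply: le_trans (word_map_contracts _ _ _) _; rewrite size_prefix_of.
have tail_fin : spread_sum x w m \is a fin_num.
  by rewrite ge0_fin_numE ?spread_sum_ge0// (lt_trans tail_m)// ltry.
move: tail_m (xsC x m) (ysD x m); rewrite -!/(spread_sum x w m).
rewrite -(fineK tail_fin); move: (fine _) => t.
rewrite lte_fin -!EFinM !lee_fin ltr_pdivlMr// => /ltW te xm ym.
apply: le_trans te; rewrite mulrC -ler_pdivlMr ?exprn_gt0//.
apply: le_trans (metric_triangle _ x _) _; rewrite metric_sym.
apply: le_trans (lerD xm ym) _.
suff -> : C * c ^- m.+1 * t + D * c ^- m.+1 * t =
  t * ((C + D) / c) / c ^+ m by [].
by rewrite exprS; field; rewrite expf_neq0 // c_neq0.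
Qed.

Lemma projectionE x w xs : (spread_sum x w 0 < +oo)%E ->
  projection_seq c f z w xs -> projection c f z w = xs 0%N.
Proof.
move=> fin_sum xsP.
have [|ys ysP ys0] := @getPex _
    [set a | exists2 xs, projection_seq c f z w xs & xs 0%N = a].
  by exists (xs 0%N), xs.
by rewrite /projection -ys0; exact: (projection_seq_unique fin_sum ysP xsP).
Qed.

Lemma projection_bound x w : (spread_sum x w 0 < +oo)%E ->
  ((mdist x (projection c f z w))%:E <= ((1 + c) / c)%:E * spread_sum x w 0)%E.
Proof.
move=> fin_sum; have [xs xsP bound] := exists_projection_seq fin_sum.
by rewrite (projectionE fin_sum xsP).
Qed.

(** The projection intertwines the shift with the maps of the system; this is
    property (i) read along a single word. *)
Lemma projection_prefix x w n : (spread_sum x w 0 < +oo)%E ->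
  projection c f z w =
  word_map f (prefix_of w n) (projection c f z (shift_by n w)).
Proof.
move=> fin_sum; have [xs xsP _] := exists_projection_seq fin_sum.
rewrite (projectionE fin_sum xsP).
rewrite (projectionE (spread_sum_shift_lty n fin_sum) (projection_seq_shift n xsP)).
by rewrite addn0; exact: projection_seq_word_map.
Qed.

End ProjectionMap.

(** * Limit sets of the subtrees *)

Section LimitSets.
Context {R : realType} {X : completeMetricType R} {I : countType}.
Variables (c : R) (f : I -> X -> X) (z : I -> X).
Variables (T : set (nat -> I)) (x : X).
Hypothesis treeT : is_tree T.
Hypothesis c01 : 0 < c < 1.
Hypothesis f_contracts : forall i x y, mdist (f i x) (f i y) <= c * mdist x y.
Hypothesis z_fixed : forall i, f i (z i) = z i.
Hypothesis summable : (tail_sum c z T x 1 < +oo)%E.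
Implicit Types (w v : nat -> I) (s : seq I) (K : seq I -> set X).

Local Notation L := (fun s : seq I => limit_set c f z (subtree T s)).

Let c_gt0 : 0 < c. Proof. by case/andP: c01. Qed.
Let c_ge0 : 0 <= c. Proof. exact: ltW. Qed.
Let c_neq0 : c != 0. Proof. exact: lt0r_neq0. Qed.
Let T_nonempty : T !=set0. Proof. by case: treeT. Qed.

Lemma max_dist_ge0 k : (0 <= max_dist z T x k)%E.
Proof.
have [w Tw] := T_nonempty.
have [i Ti] : letters T k !=set0.
  by case: k => [|k]; [rewrite letters0//; exists (w 0%N)|exists (w k)];
    exact: letters_nth.
apply: le_trans (ereal_sup_ubound _); last by exists i.
by rewrite lee_fin mdist_ge0.
Qed.

Let term_ge0 k : (0 <= max_dist z T x k * (c ^+ k)%:E)%E.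
Proof. by rewrite mule_ge0 ?max_dist_ge0// lee_fin exprn_ge0. Qed.

Lemma tail_sum_addn l n : tail_sum c z T x (l + n) =
  (\sum_(l <= k <oo) max_dist z T x (k + n) * (c ^+ (k + n))%:E)%E.
Proof.
rewrite /tail_sum -(nneseries_addn (l + n)) //.
rewrite -(nneseries_addn l); last by move=> k; exact: term_ge0.
by apply: eq_eseriesr => k _; rewrite addnA.
Qed.

Lemma tail_sum_lt (eps : R) : 0 < eps ->
  exists N, forall n, (N <= n)%N -> (tail_sum c z T x n.+1 < eps%:E)%E.
Proof.
move=> eps0; have sumS := tail_sum_addn 0 1.
have := summable; rewrite -[1%N]add0n sumS.
move=> /(nneseries_tail_lt (fun k => term_ge0 (k + 1)))/(_ eps0)[N NP].
by exists N => n /NP; rewrite -tail_sum_addn addn1.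
Qed.

(** [b_x(l)] as a real number, so that the remaining estimates take place in a
    field; [tail_sumE] is the passage from one to the other. *)
Definition real_tail (l : nat) : R := fine (tail_sum c z T x l).

Lemma tail_sumE n : tail_sum c z T x n.+1 = (real_tail n.+1)%:E.
Proof.
rewrite fineK// ge0_fin_numE; last first.
  by apply: nneseries_ge0 => k _ _; exact: term_ge0.
apply: le_lt_trans summable.
rewrite /tail_sum (nneseries_split 1 n) // add1n leeDr//.
by apply: sume_ge0 => k _; exact: term_ge0.
Qed.

Lemma spread_sum_subtree s w : subtree T s w ->
  (spread_sum c z x w 0 <=
   (c ^- size s)%:E * tail_sum c z T x (size s).+1)%E.
Proof.
move=> sw; rewrite -[(size s).+1]add0n tail_sum_addn -nneseriesZl; last first.
  by move=> k _; exact: term_ge0.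
apply: lee_nneseries => [k _ _|k _].
  exact: spread_ge0.
rewrite addnS addnC muleCA -EFinM -addnS exprD mulKf ?expf_neq0//.
rewrite /spread EFinM muleC lee_wpmul2r//.
  by rewrite lee_fin exprn_ge0.
apply: ereal_sup_ubound; exists (w k) => //.
by rewrite addnS; exact: letters_subtree.
Qed.

Lemma spread_sum_subtree_lty s w : subtree T s w ->
  (spread_sum c z x w 0 < +oo)%E.
Proof.
by move=> /spread_sum_subtree; rewrite tail_sumE -EFinM => /le_lt_trans; apply;
  exact: ltry.
Qed.

Lemma mdist_limit_set s a : L s a ->
  mdist x a <= (1 + c) * (c ^- (size s).+1 * real_tail (size s).+1).
Proof.
move=> [w sw <-]; rewrite -lee_fin.
apply: le_trans
  (projection_bound c01 f_contracts z_fixed (spread_sum_subtree_lty sw)) _.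
apply: le_trans (lee_wpmul2l _ (spread_sum_subtree sw)) _.
  by rewrite lee_fin divr_ge0// addr_ge0.
by rewrite tail_sumE -!EFinM lee_fin exprS invfM !mulrA.
Qed.

Lemma limit_set_nonempty s : words T s -> L s !=set0.
Proof.
move=> /(subtree_nonempty T_nonempty)[w sw].
by exists (projection c f z w), w.
Qed.

Lemma limit_set_self_similar : self_similar f T L.
Proof.
move=> s n _ _; apply/seteqP; split => a.
  case=> s' s'n [b [w sw <-] <-].
  move: sw; rewrite subtree_cat => -[v [sv vs'] <-].
  exists v => //.
  by rewrite {1}(projection_prefix c01 f_contracts z_fixed (size s')
    (spread_sum_subtree_lty sv)) vs'.
case=> w sw <-; exists (prefix_of w n); first by exists w.
exists (projection c f z (shift_by n w)); last first.
  by rewrite -(projection_prefix c01 f_contracts z_fixed n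
    (spread_sum_subtree_lty sw)).
by exists (shift_by n w) => //; rewrite subtree_cat; exact: shift_subtree.
Qed.

(** Modulus of continuity of the projection: two words that agree on [n] letters
    have images under the same composition of [n] maps of two points that
    [mdist_limit_set] places near [x]. *)
Lemma mdist_projection_prefix s n w v : subtree T s w -> subtree T s v ->
  prefix_of w n = prefix_of v n ->
  mdist (projection c f z w) (projection c f z v) <=
    (1 + c) * 2 * c ^- (size s).+1 * real_tail (size s + n).+1.
Proof.
move=> sw sv wv.
rewrite (projection_prefix c01 f_contracts z_fixed n
    (spread_sum_subtree_lty sw)).
rewrite (projection_prefix c01 f_contracts z_fixed n
    (spread_sum_subtree_lty sv)).
rewrite -wv; apply: le_trans (word_map_contracts c01 f_contracts _ _ _) _.
rewrite size_prefix_of.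
have bound u : subtree T s u -> prefix_of w n = prefix_of u n ->
    mdist x (projection c f z (shift_by n u)) <=
    (1 + c) * (c ^- (size s + n).+1 * real_tail (size s + n).+1).
  move=> su wu; have := @mdist_limit_set (s ++ prefix_of u n).
  rewrite size_cat size_prefix_of; apply; exists (shift_by n u) => //.
  by rewrite subtree_cat; exact: shift_subtree.
apply: (@le_trans _ _ (c ^+ n *
   ((1 + c) * (c ^- (size s + n).+1 * real_tail (size s + n).+1) *+ 2))).
  rewrite ler_wpM2l ?exprn_ge0//.
  apply: le_trans (metric_triangle _ x _) _.
  by rewrite metric_sym mulr2n lerD// bound.
rewrite le_eqVlt; apply/orP; left; apply/eqP.
by rewrite -addSn exprD; field; rewrite !expf_neq0.
Qed.

(** The limit set at [s] is an image of the compact set of words of [T] that start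
    with [s], under the shift followed by the projection. *)
Lemma limit_set_compact s : compact (L s).
Proof.
rewrite /limit_set /subtree image_comp.
apply: (@continuous_compact {ptws nat -> discrete_topology I} X);
  last exact: compact_through.
apply/subspace_continuousP => v sv.
apply/metricType_numDomainType.cvgrPdist_lt => eps eps0.
have fac0 : 0 < (1 + c) * 2 * c ^- (size s).+1.
  by rewrite !mulr_gt0 ?addr_gt0// invr_gt0 exprn_gt0.
have [|N NP] := @tail_sum_lt (eps / ((1 + c) * 2 * c ^- (size s).+1)).
  by rewrite divr_gt0.
have nbhsF : Filter (nbhs (v : {ptws nat -> discrete_topology I})).
  exact: nbhs_filter.
have := nbhs_cylinder v (size s + N)%N.
apply: filterS => u /= uv su.
have eq_tails : prefix_of (shift_by (size s) v) N =
                prefix_of (shift_by (size s) u) N.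
  by apply/esym/eqP; move/eqP: uv; rewrite !prefix_of_cat
    eqseq_cat ?size_prefix_of// => /andP[].
apply: le_lt_trans (mdist_projection_prefix (s := s) _ _ eq_tails) _.
- by exists v.
- by exists u.
have := NP (size s + N)%N (leq_addl _ _); rewrite tail_sumE lte_fin.
by rewrite ltr_pdivlMr// mulrC.
Qed.

(** Property (ii) for all pairs of points rather than for the Hausdorff distance;
    this is the form that can be transported by the maps of the system. *)
Lemma limit_set_pairwise_growth (A : set X) : compact A ->
  exists2 D : R, 0 < D & forall s a b, A a -> L s b ->
    mdist a b <= D * Num.max 1 (c ^- (size s).+1 * real_tail (size s).+1).
Proof.
move=> /(compact_mdist_bounded x)[M M0 AM]; exists (M + (1 + c)).
  by rewrite !addr_gt0.
move=> s a b /AM ax /mdist_limit_set xb.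
apply: le_trans (metric_triangle _ x _) _.
apply: le_trans (lerD ax xb) _.
rewrite [leRHS]mulrDl lerD//.
  by rewrite -{1}[M]mulr1 ler_wpM2l ?le_max ?lexx// ltW.
by rewrite ler_wpM2l ?addr_ge0// le_max lexx orbT.
Qed.

Lemma growth_maxE s :
  maxe 1%E ((c ^- (size s).+1)%:E * tail_sum c z T x (size s).+1)%E =
  (Num.max 1 (c ^- (size s).+1 * real_tail (size s).+1))%:E.
Proof. by rewrite tail_sumE -EFinM EFin_max. Qed.

Lemma limit_set_controlled_growth : controlled_growth c z T x L.
Proof.
move=> A [[a0 Aa0] /limit_set_pairwise_growth[D D0 AL]]; exists D => // s sT.
have [b0 Lb0] := limit_set_nonempty sT.
rewrite growth_maxE -EFinM; apply: hausdorff_dist_le => [a Aa|b Lb].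
  by exists b0 => //; rewrite lee_fin; exact: AL.
by exists a0 => //; rewrite lee_fin metric_sym; exact: AL.
Qed.

(** The rescaling behind both uniqueness and the final estimate: [c^n] turns the
    growth bound at [s ++ s'] into a quantity that tends to 0 as [n] grows. *)
Lemma mdist_word_map_growth s s' n (D : R) a b : size s' = n ->
  mdist a b <= D * Num.max 1 (c ^- (size (s ++ s')).+1 *
                              real_tail (size (s ++ s')).+1) ->
  mdist (word_map f s' a) (word_map f s' b) <=
    D * c ^- (size s).+1 *
      Num.max (c ^+ (n + (size s).+1)) (real_tail (n + (size s).+1)).
Proof.
move=> s'n ab.
apply: le_trans (word_map_contracts c01 f_contracts _ _ _) _.
rewrite s'n; apply: le_trans (ler_wpM2l (exprn_ge0 _ c_ge0) ab) _.
rewrite size_cat s'n -addSn addnC.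
set l := (n + _)%N.
have -> : c ^+ n = c ^- (size s).+1 * c ^+ l.
  by rewrite /l addnC exprD mulKf// expf_neq0.
rewrite -[_ * c ^+ l * _]mulrA [c ^+ l * _]mulrCA maxr_pMr ?exprn_ge0//.
by rewrite mulr1 mulVKf ?expf_neq0// mulrCA mulrA.
Qed.

(** One half of uniqueness, kept asymmetric because it is used in both directions.
    Growth relative to the singleton of [x] bounds the distance between the points
    [a'] and [b'] chosen deep in the tree. *)
Lemma controlled_family_sub K K' :
  (forall s, words T s -> K' s !=set0) ->
  self_similar f T K -> self_similar f T K' ->
  controlled_growth c z T x K -> controlled_growth c z T x K' ->
  forall s, words T s -> closed (K' s) -> K s `<=` K' s.
Proof.
move=> K'0 simK simK' growK growK' s sT clK' b Kb; apply: clK'.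
have x_compact : nonempty_compact [set x].
  by split; [exists x|exact: compact_set1].
have [D D0 DP] := growK _ x_compact; have [D' D'0 D'P] := growK' _ x_compact.
move=> U /metricType_numDomainType.nbhs_mdistP[eps /= eps0 epsU].
have fac0 : 0 < (D + D') * c ^- (size s).+1.
  by rewrite mulr_gt0 ?addr_gt0// invr_gt0 exprn_gt0.
have del0 : 0 < eps / ((D + D') * c ^- (size s).+1) by rewrite divr_gt0.
have [N NP] := tail_sum_lt del0.
have cvc : c ^+ n @[n --> \oo] --> (0 : R).
  by apply: cvg_expr; rewrite ger0_norm//; case/andP: c01.
have [N' _ N'P] : \forall n \near \oo, c ^+ n < eps / ((D + D') * c ^- (size s).+1).
  by apply: cvgr_lt cvc _ _.
(* Beyond N the tail b_x is small, beyond N' the power of c is small; the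
   successor makes the length positive. *)
pose n := (maxn N N').+1.
move: Kb; rewrite -(simK s n)// => -[s' s'n [b' Kb' bE]].
have ss'T := words_cat s'n.
have [a' Ka'] := K'0 _ ss'T.
exists (word_map f s' a'); split.
  by rewrite -(simK' s n)//; exists s' => //; exists a'.
apply: epsU => /=; rewrite -bE.
have := mdist_word_map_growth (n := n) (D := D + D') (a := b') (b := a') (s := s)
  (s' := s') (size_words_of_length s'n).
move=> /(_ _)/le_lt_trans; apply.
  apply: le_trans (metric_triangle _ x _) _; rewrite mulrDl metric_sym.
  apply: lerD; rewrite -lee_fin EFinM -growth_maxE.
    exact: le_trans (mdist_le_hausdorff_set1 _ Kb') (DP _ ss'T).
  exact: le_trans (mdist_le_hausdorff_set1 _ Ka') (D'P _ ss'T).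
rewrite mulrC -ltr_pdivlMr// gt_max; apply/andP; split.
  apply: N'P => /=; rewrite (leq_trans _ (leq_addr _ _))// /n ltnW// ltnS.
  exact: leq_maxr.
rewrite -lte_fin addnS -tail_sumE; apply: NP.
by rewrite (leq_trans _ (leq_addr _ _))// /n ltnW// ltnS leq_maxl.
Qed.

Lemma word_map_images_approx (A : set X) : nonempty_compact A ->
  exists2 D : R, 0 < D & forall s n, words T s -> (0 < n)%N ->
    (hausdorff_dist
       (\bigcup_(s' in words_of_length (subtree T s) n) (word_map f s' @` A))
       (L s) <=
     (D * c ^- (size s).+1)%:E *
       maxe (c ^+ (n + (size s).+1))%:E
            (tail_sum c z T x (n + (size s).+1)))%E.
Proof.
move=> [[a0 Aa0] /limit_set_pairwise_growth[D D0 AL]]; exists D => // s n sT n0.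
rewrite addnS tail_sumE -EFin_max -EFinM -addnS.
apply: hausdorff_dist_le => [_ [s' s'n [a Aa <-]]|b].
  have [b Lb] := limit_set_nonempty (words_cat s'n).
  exists (word_map f s' b).
    by rewrite -(limit_set_self_similar sT n0); exists s' => //; exists b.
  rewrite lee_fin mdist_word_map_growth ?(size_words_of_length s'n)//.
  exact: AL.
rewrite -(limit_set_self_similar sT n0) => -[s' s'n [b' Lb' <-]].
exists (word_map f s' a0); first by exists s' => //; exists a0.
rewrite lee_fin mdist_word_map_growth ?(size_words_of_length s'n)//.
by rewrite metric_sym; exact: AL.
Qed.

End LimitSets.

(** * The theorem *)

Theorem theorem4p5 (R : realType) (X : completeMetricType R) (I : countType)
    (T : set (nat -> I)) (f : I -> X -> X) (c : R) (z : I -> X) (x : X)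
    (Hifs : general_ifs c f T)
    (Hz : forall i, unique (fun y => f i y = y) (z i))
    (Hsum : (\sum_(1 <= n <oo) max_dist z T x n * (c ^+ n)%:E < +oo)%E) :
  let L := fun s : seq I => limit_set c f z (subtree T s) in
  [/\ forall s, words T s -> nonempty_compact (L s),
      self_similar f T L,
      controlled_growth c z T x L,
      forall K : seq I -> set X,
        (forall s, words T s -> nonempty_compact (K s)) ->
        self_similar f T K ->
        controlled_growth c z T x K ->
        forall s, words T s -> K s = L s
    & forall A : set X, nonempty_compact A ->
        exists2 D : R, 0 < D & forall s n, words T s -> (0 < n)%N ->
          (hausdorff_dist
             (\bigcup_(s' in words_of_length (subtree T s) n)
                (word_map f s' @` A))
             (L s) <=
           (D * c ^- (size s).+1)%:E *
             maxe (c ^+ (n + (size s).+1))%:E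
                  (tail_sum c z T x (n + (size s).+1)))%E].
Proof.
have [treeT c01 f_contracts] := Hifs.
have z_fixed i : f i (z i) = z i by case: (Hz i).
have compactL s : words T s -> nonempty_compact (limit_set c f z (subtree T s)).
  move=> sT; split; first by apply: limit_set_nonempty.
  exact: (limit_set_compact (x := x)).
have simL : self_similar f T (fun s => limit_set c f z (subtree T s)).
  exact: (limit_set_self_similar (x := x)).
have growL := limit_set_controlled_growth treeT c01 f_contracts z_fixed Hsum.
split => //; last exact: word_map_images_approx.
move=> K compactK simK growK s sT.
have closed_of B : nonempty_compact B -> closed (B : set X).
  by move=> [_]; apply: compact_closed; exact: metric_hausdorff.
apply/seteqP; split.
  apply: (controlled_family_sub treeT c01 f_contracts Hsum
            _ simK simL growK growL sT); first by move=> t /compactL[].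
  by apply: closed_of; exact: compactL.
apply: (controlled_family_sub treeT c01 f_contracts Hsum
          _ simL simK growL growK sT); first by move=> t /compactK[].
by apply: closed_of; exact: compactK.
Qed.
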